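(* Let $F$ and $\overline F$ be two Finsler metrics on a smooth $n$-dimensional manifold $M$ that are proportional, i.e. $\overline F(x,y)=\Psi(x,y)F(x,y)$ for a positive smooth function $\Psi$ on $TM\setminus0$. Then the associated Finsler metric tensors $g_{ij}$ and $\overline g_{ij}$ are proportional (i.e. $\overline g_{ij}(x,y)=\lambda(x,y)g_{ij}(x,y)$ for some positive smooth function $\lambda$ on $TM\setminus 0$) if and only if $\Psi$ is a function of position $x$ only, i.e. $\partial\Psi/\partial y^i=0$ on $TM\setminus0$ for all $i$.
   Context: $(x^i,y^i)$ are the coordinates on $TM$ induced by local coordinates $(x^i)$ on $M$. A Finsler metric on $M$ is a function $F$, smooth on the slit tangent bundle $TM\setminus0$, positive there, positively homogeneous of degree one in $y$, whose metric tensor $g_{ij}=\tfrac12\,\partial^2F^2/\partial y^i\partial y^j$ is positive definite at each point of $TM\setminus 0$. *)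

(* Defs.v *)
From HB Require Import structures.
From mathcomp Require Import all_boot all_order all_algebra.
From mathcomp Require Import all_classical all_reals all_analysis.
Import Order.TTheory GRing.Theory Num.Theory.
Import numFieldNormedType.Exports.
Set Implicit Arguments.
Unset Strict Implicit.
Unset Printing Implicit Defensive.
Local Open Scope classical_set_scope.
Local Open Scope ring_scope.

(* Meant for an open set U of a finite-dimensional space V: then the
   continuity of x |-> 'd f x for the operator norm is that of x |-> 'd f x v
   for every v, so the recursion on the latter is the usual C^k class. *)
Fixpoint Ck (R : realType) (V W : normedModType R) (k : nat)
    (U : set V) (f : V -> W) : Prop :=
  if k is k'.+1 then
    (forall x, U x -> differentiable f x) /\
    (forall v, Ck k' U (fun x => 'd f x v))
  else forall x, U x -> {for x, continuous f}.

Definition smooth_on (R : realType) (V W : normedModType R)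
    (U : set V) (f : V -> W) : Prop := forall k, Ck k U f.

(* cinv is a total function; only its values on the image of cdom matter. *)
Record chart (R : realType) (n : nat) (M : topologicalType) := Chart {
  cdom : set M;
  cmap : M -> 'rV[R]_n;
  cinv : 'rV[R]_n -> M;
  cdom_open : open cdom;
  cimg_open : open (cmap @` cdom);
  cmapK : forall p, cdom p -> cinv (cmap p) = p;
  cmap_continuous : forall p, cdom p -> {for p, continuous cmap};
  cinv_continuous : forall x, (cmap @` cdom) x -> {for x, continuous cinv} }.

Record manifold (R : realType) (n : nat) := Manifold {
  carrier :> topologicalType;
  carrier_hausdorff : hausdorff_space carrier;
  carrier_second_countable : @second_countable carrier;
  chart_index : Type;
  atlas : chart_index -> chart R n carrier;
  atlas_cover : forall p, exists a, cdom (atlas a) p;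
  atlas_smooth : forall a b,
    smooth_on (cmap (atlas a) @` (cdom (atlas a) `&` cdom (atlas b)))
              (cmap (atlas b) \o cinv (atlas a)) }.

Section Manifold.
Variables (R : realType) (n : nat) (M : manifold R n).
Implicit Types (a b c : chart_index M) (p : M) (x y : 'rV[R]_n).

Definition dom a : set M := cdom (atlas a).
Definition phi a : M -> 'rV[R]_n := cmap (atlas a).
Definition psi a : 'rV[R]_n -> M := cinv (atlas a).
Definition img a : set 'rV[R]_n := phi a @` dom a.

(* A tangent vector is a base point with its components in all the charts
   around that point; [tcomp_out] only makes the representation unique. *)
Record tangent := Tangent {
  tpt : M;
  tcomp : chart_index M -> 'rV[R]_n;
  tcomp_change : forall a b, dom a tpt -> dom b tpt ->
    tcomp b = 'd (phi b \o psi a) (phi a tpt) (tcomp a);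
  tcomp_out : forall a, ~ dom a tpt -> tcomp a = 0 }.

Lemma phiK a p : dom a p -> psi a (phi a p) = p.
Proof. exact: cmapK. Qed.

Lemma psiK a x : img a x -> phi a (psi a x) = x.
Proof. by case=> p ap <-; rewrite phiK. Qed.

Lemma psi_dom a x : img a x -> dom a (psi a x).
Proof. by case=> p ap <-; rewrite phiK. Qed.

Lemma img_open a : open (img a).
Proof. exact: (@cimg_open _ _ _ (atlas a)). Qed.

Lemma change_differentiable a b p : dom a p -> dom b p ->
  differentiable (phi b \o psi a) (phi a p).
Proof. by move=> ap bp; apply: (atlas_smooth a b 1).1; exists p. Qed.

Lemma near_psi_dom a b p : dom a p -> dom b p ->
  \forall x \near phi a p, img a x /\ dom b (psi a x).
Proof.
move=> ap bp; have ia : img a (phi a p) by exists p.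
near=> x; split; near: x.
  by apply: open_nbhs_nbhs; split=> //; exact: img_open.
apply: (cinv_continuous (c := atlas a) ia); rewrite [cinv _ _](phiK ap).
by apply: open_nbhs_nbhs; split=> //; exact: cdom_open.
Unshelve. all: by end_near. Qed.

Lemma diff_near_eq (V W : normedModType R) (f g : V -> W) (z v : V) :
  differentiable f z -> differentiable g z ->
  (\forall w \near z, f w = g w) -> 'd f z v = 'd g z v.
Proof.
move=> df dg fg; have [->|v0] := eqVneq v 0; first by rewrite !linear0.
by rewrite -!deriveE//; exact: near_eq_derive.
Qed.

Lemma diff_chain (U V W : normedModType R) (f : U -> V) (g : V -> W) u v h :
  f u = v -> differentiable f u -> differentiable g v ->
  differentiable (g \o f) u /\ 'd g v ('d f u h) = 'd (g \o f) u h.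
Proof.
move=> <- df dg; split; first exact: differentiable_comp.
by rewrite [in RHS]diff_comp.
Qed.

Lemma change_id a p y : dom a p -> 'd (phi a \o psi a) (phi a p) y = y.
Proof.
move=> ap; rewrite (diff_near_eq y (g := id)).
- by rewrite diff_val.
- exact: change_differentiable.
- exact: ex_diff.
- by near=> x; rewrite /= psiK//; near: x;
    apply: filterS (near_psi_dom ap ap) => ? [].
Unshelve. all: by end_near. Qed.

Lemma change_comp a b c p y : dom a p -> dom b p -> dom c p ->
  'd (phi c \o psi b) (phi b p) ('d (phi b \o psi a) (phi a p) y) =
  'd (phi c \o psi a) (phi a p) y.
Proof.
move=> ap bp cp.
have E : (phi b \o psi a) (phi a p) = phi b p by rewrite /comp phiK.
have dba := change_differentiable ap bp.
have dcb := change_differentiable bp cp.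
have [dcba dE] := diff_chain y E dba dcb; apply: (etrans dE).
apply: diff_near_eq; first exact: dcba.
   exact: change_differentiable.
by near=> x; rewrite /comp phiK//; near: x;
  apply: filterS (near_psi_dom ap bp) => ? [].
Unshelve. all: by end_near. Qed.

Section OfCoordinates.
Variables (a : chart_index M) (x y : 'rV[R]_n).

Definition tvec_comp b : 'rV[R]_n :=
  if (x \in img a) && (psi a x \in dom b) then 'd (phi b \o psi a) x y else 0.

Lemma tvec_change b c : dom b (psi a x) -> dom c (psi a x) ->
  tvec_comp c = 'd (phi c \o psi b) (phi b (psi a x)) (tvec_comp b).
Proof.
move=> bx cx; rewrite /tvec_comp (mem_set bx) (mem_set cx) !andbT.
case E : (x \in img a); last exact/esym/linear0.
have ax := set_mem E; have H := change_comp y (psi_dom ax) bx cx.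
by rewrite (psiK ax) in H; exact/esym.
Qed.

Lemma tvec_out b : ~ dom b (psi a x) -> tvec_comp b = 0.
Proof. by move=> bx; rewrite /tvec_comp (memNset bx) andbF. Qed.

(* The tangent vector with coordinates (x, y) in the chart a, for x in img a
   (and a zero vector for the other x). *)
Definition tvec : tangent := Tangent tvec_change tvec_out.

End OfCoordinates.

(* The two lemmas below say that (x, y) are coordinates on TM. *)
Lemma tvecK a x y : img a x ->
  tpt (tvec a x y) = psi a x /\ tcomp (tvec a x y) a = y.
Proof.
move=> ax; split=> //=; have ap := psi_dom ax.
rewrite /tvec_comp (mem_set ax) (mem_set ap) /=.
by have H := change_id y ap; rewrite (psiK ax) in H.
Qed.

Lemma tvec_tcomp a (v : tangent) : dom a (tpt v) ->
  tvec a (phi a (tpt v)) (tcomp v a) = v.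
Proof.
case: v => p t tc to /= ap.
have E : tvec_comp a (phi a p) (t a) = t.
  have ia : img a (phi a p) by exists p.
  apply/funext => b; rewrite /tvec_comp (phiK ap) (mem_set ia) /=.
  case E : (p \in dom b); first exact/esym/(tc a b ap)/set_mem.
  by apply/esym/to => bp; rewrite (mem_set bp) in E.
rewrite /tvec; move: (@tvec_change _ _ _) (@tvec_out _ _ _).
rewrite E (phiK ap).
by move=> tc' to'; congr Tangent; exact: Prop_irrelevance.
Qed.

Section Scale.
Variables (t : R) (v : tangent).

Lemma tscale_change a b : dom a (tpt v) -> dom b (tpt v) ->
  t *: tcomp v b = 'd (phi b \o psi a) (phi a (tpt v)) (t *: tcomp v a).
Proof. by move=> ap bp; rewrite linearZ (tcomp_change ap bp). Qed.

Lemma tscale_out a : ~ dom a (tpt v) -> t *: tcomp v a = 0.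
Proof. by move=> ap; rewrite tcomp_out// scaler0. Qed.

Definition tscale : tangent := Tangent tscale_change tscale_out.

End Scale.

(* Functions on TM \ 0 are encoded as functions on [tangent] whose values at
   zero vectors are irrelevant. *)
Definition slit : set tangent := [set v | exists a, tcomp v a != 0].

Definition loc (f : tangent -> R) a (x y : 'rV[R]_n) : R := f (tvec a x y).

Definition smooth_slit (f : tangent -> R) : Prop := forall a,
  smooth_on [set z : 'rV[R]_n * 'rV[R]_n | img a z.1 /\ z.2 != 0]
            (fun z => loc f a z.1 z.2).

(* The partial derivative with respect to y^i. *)
Definition dy (i : 'I_n) (h : 'rV[R]_n -> 'rV[R]_n -> R) (x y : 'rV[R]_n) : R :=
  'D_(delta_mx 0 i) (h x) y.

Definition metric_tensor (F : tangent -> R) a (x y : 'rV[R]_n) : 'M[R]_n :=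
  \matrix_(i, j) (2^-1 * dy i (dy j (loc (fun v => F v ^+ 2) a)) x y).

Definition posdef (g : 'M[R]_n) : Prop :=
  forall w : 'rV[R]_n, w != 0 -> 0 < (w *m g *m w^T) 0 0.

Record finsler_metric (F : tangent -> R) : Prop := FinslerMetric {
  finsler_smooth : smooth_slit F;
  finsler_pos : forall v, slit v -> 0 < F v;
  finsler_homogeneous : forall (t : R) v, 0 < t -> slit v ->
    F (tscale t v) = t * F v;
  finsler_posdef : forall a x y, img a x -> y != 0 ->
    posdef (metric_tensor F a x y) }.

End Manifold.

(* Main.v *)
(* Fix x and put f = F^2, g = Fbar^2 = Psi^2 f, which are 2-homogeneous in y.
   If the y-Hessians satisfy Hess g = lambda Hess f, contracting once with y
   (Euler, for the 1-homogeneous partial derivatives) gives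
   grad g = lambda grad f, and contracting again gives g = lambda f, so
   lambda = Psi^2.  Since grad (Psi^2 f) = Psi^2 grad f + 2 f Psi grad Psi and
   f Psi > 0, grad Psi = 0.  Conversely, Psi^2 behaves as a constant under
   y-derivatives and lambda = Psi^2 works. *)
Require Import Defs.
From mathcomp Require Import all_boot all_order all_algebra.
From mathcomp Require Import all_classical all_reals all_analysis.
From mathcomp Require Import ring.
Import Order.TTheory GRing.Theory Num.Theory.
Import numFieldNormedType.Exports.
Local Open Scope ring_scope.

Set Implicit Arguments.
Unset Strict Implicit.
Unset Printing Implicit Defensive.

(** Differentiability is a local property: [f] and [g] have the same first-order remainder near [x],
    so the expansion of [f] serves for [g], and uniqueness of the differential identifies ['d g x]
    with ['d f x]. *)
Lemma near_eq_differentiable (R : realType) (V W : normedModType R)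
    (f g : V -> W) (x : V) :
  (\forall z \near x, f z = g z) -> differentiable f x -> differentiable g x.
Proof.
move=> fg df; have dg : g \o shift x = cst (g x) + 'd f x +o_ 0 id.
  apply/eqaddoP => e e0; near=> h.
  have -> : (g \o shift x - (cst (g x) + 'd f x)) h =
            (f \o shift x - (cst (f x) + 'd f x)) h.
    rewrite !fctE /= (nbhs_singleton fg); congr (_ - _); apply/esym.
    near: h; move: fg; rewrite (near_shift 0 x).
    by apply: filterS => z /=; rewrite subr0.
  by near: h; have /eqaddoP := diff_locally df; exact.
have cf : continuous ('d f x) by exact: diff_continuous.
by apply/diff_locallyP; rewrite (diff_unique cf dg).
Unshelve. all: by end_near. Qed.

(** * Sums and products of functions of class C^k on an open set *)

Section Ck_theory.
Context (R : realType) (V : normedModType R) (U : set V).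
Hypothesis U_open : open U.
Implicit Types (f g : V -> R) (k : nat).

Lemma near_open x : U x -> \forall z \near x, U z.
Proof. by move=> Ux; apply: open_nbhs_nbhs. Qed.

(** As [U] is open, equality on [U] is equality near each of its points. This lets the sum and
    product rules, which hold only on [U], be used inside the recursion of [Ck]. *)
Lemma eq_Ck k f g : (forall x, U x -> f x = g x) -> Ck k U f -> Ck k U g.
Proof.
elim: k f g => [|k IH] f g fg /=.
  move=> cf x Ux; rewrite /prop_for /continuous_at -fg//.
  apply: cvg_trans (cf x Ux); apply: near_eq_cvg.
  by apply: filterS (near_open Ux) => z /fg.
move=> [df ddf].
have dg x : U x -> differentiable g x.
  move=> Ux; apply: near_eq_differentiable (df x Ux).
  by apply: filterS (near_open Ux) => z /fg.
split=> // v; apply: IH (ddf v) => x Ux.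
apply: diff_near_eq; [exact: df|exact: dg|].
by apply: filterS (near_open Ux) => z /fg.
Qed.

Lemma CkS k f : Ck k.+1 U f -> Ck k U f.
Proof.
elim: k f => [|k IH] f [df ddf].
  by move=> x /df; apply: differentiable_continuous.
by split=> // v; apply/IH/ddf.
Qed.

Lemma CkD k f g : Ck k U f -> Ck k U g -> Ck k U (f + g).
Proof.
elim: k f g => [|k IH] f g.
  by move=> cf cg x Ux; apply: continuousD; [exact: cf|exact: cg].
move=> [df ddf] [dg ddg]; split=> [x Ux|v].
  by apply: differentiableD; [exact: df|exact: dg].
apply: eq_Ck (IH _ _ (ddf v) (ddg v)) => x Ux.
by rewrite diffD//; [exact: df|exact: dg].
Qed.

(** The Leibniz rule mixes each function with the differential of the other, so [CkS] first lowers
    [f] and [g] to the class of the differentials. *)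
Lemma CkM k f g : Ck k U f -> Ck k U g -> Ck k U (f * g).
Proof.
elim: k f g => [|k IH] f g.
  by move=> cf cg x Ux; apply: continuousM; [exact: cf|exact: cg].
move=> fk gk; have [[df ddf] [dg ddg]] := (fk, gk); split=> [x Ux|v].
  by apply: differentiableM; [exact: df|exact: dg].
apply: eq_Ck (CkD (IH _ _ (CkS fk) (ddg v)) (IH _ _ (CkS gk) (ddf v))) => x Ux.
by rewrite diffM//; [exact: df|exact: dg].
Qed.

End Ck_theory.

(** * Positively homogeneous functions and Euler's theorem *)

Section Homogeneous.
Context (R : realType) (V : normedModType R).
Implicit Types (f : V -> R) (y v : V) (k : nat).

Definition pos_homogeneous k f : Prop :=
  forall t y, 0 < t -> y != 0 -> f (t *: y) = t ^+ k * f y.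

Lemma near_neq0 y : y != 0 -> \forall z \near y, z != 0.
Proof. by move=> y0; apply: cvgr_neq0 y0; exact: cvg_id. Qed.

(** The map sending [t] to [f (t *: y)] is differentiated at [t = 1] twice: by the chain rule, and
    as [t ^+ k * f y]. *)
Lemma euler_homogeneous k f y : pos_homogeneous k f -> y != 0 ->
  differentiable f y -> 'D_y f y = k%:R * f y.
Proof.
move=> hf y0 df.
have ds : is_diff (1 : R) ( *:%R^~ y) ( *:%R^~ y) by exact: is_diff_scalel.
have df1 : differentiable f (1 *: y) by rewrite scale1r.
have <- : 'D_1 (f \o *:%R^~ y) (1 : R) = 'D_y f y.
  rewrite !deriveE//; last exact: differentiable_comp.
  by rewrite diff_comp//= diff_val !scale1r.
(* Homogeneity holds for positive [t] only, which is enough near 1. *)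
rewrite (@near_eq_derive _ _ _ _ (fun t : R => t ^+ k * f y)).
  have -> : (fun t : R => t ^+ k * f y) = f y *: (@GRing.exp R ^~ k).
    by apply/funext => t; rewrite mulrC.
  rewrite deriveZ; last exact: exprn_derivable.
  by rewrite exp_derive expr1n; rewrite /GRing.scale /=; ring.
near=> t; rewrite /= hf//; near: t; exact: lt_nbhsr.
Unshelve. all: by end_near. Qed.

(** Differentiating [f (t *: z) = t ^+ k.+1 * f z] in [z] at [y] gives the claim multiplied by [t],
    which is then cancelled. *)
Lemma derive_homogeneous k f v : pos_homogeneous k.+1 f ->
  (forall y, y != 0 -> differentiable f y) -> pos_homogeneous k ('D_v f).
Proof.
move=> hf df t y t0 y0.
have ty0 : t *: y != 0 by rewrite scaler_eq0 negb_or lt0r_neq0.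
apply: (mulfI (lt0r_neq0 t0)); rewrite mulrA -exprS.
have -> : t * 'D_v f (t *: y) = 'D_v (f \o *:%R t) y.
  have dft := df _ ty0; have ds : is_diff y ( *:%R t) ( *:%R t)
    by exact: is_diff_scaler.
  rewrite !deriveE//; last exact: differentiable_comp.
  by rewrite [in RHS]diff_comp//= (diff_val (df := *:%R t)) linearZ.
rewrite (@near_eq_derive _ _ _ _ (t ^+ k.+1 *: f)).
  by rewrite deriveZ//; exact/diff_derivable/df.
by near=> z; rewrite /= hf//; near: z; exact: near_neq0.
Unshelve. all: by end_near. Qed.

End Homogeneous.

(** * Gradients and Hessians of 2-homogeneous functions on a fibre *)

Section Gradient.
Context (R : realType) (n : nat).
Implicit Types (f g p : 'rV[R]_n -> R) (y v : 'rV[R]_n) (i j : 'I_n).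

Lemma derive_sum_delta f y v : differentiable f y ->
  'D_v f y = \sum_i v 0 i * 'D_('e_i) f y.
Proof.
move=> df; rewrite deriveE// {1}(row_sum_delta v) linear_sum.
by apply: eq_bigr => i _; rewrite linearZ deriveE.
Qed.

Definition diff2_slit f : Prop := forall y, y != 0 ->
  differentiable f y /\ forall v, differentiable ('D_v f) y.

(** The sum runs over the outer derivative, so it is the derivative of ['D_('e_j) f] along [y]; that
    function is 1-homogeneous and Euler applies. *)
Lemma hessian_radial f y j : pos_homogeneous 2 f -> diff2_slit f -> y != 0 ->
  \sum_i y 0 i * 'D_('e_i) ('D_('e_j) f) y = 'D_('e_j) f y.
Proof.
move=> hf df y0; rewrite -derive_sum_delta; last exact: (df y y0).2.
rewrite (euler_homogeneous (k := 1))//; first by rewrite mul1r.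
  by apply: derive_homogeneous => // z /df[].
exact: (df y y0).2.
Qed.

(** Product rule, kept general in [f] and [g] so that it applies both to the squared metrics and to
    their partial derivatives. *)
Lemma derive_conformal p f g y v : (forall z, z != 0 -> g z = p z ^+ 2 * f z) ->
  y != 0 -> differentiable p y -> differentiable f y ->
  'D_v g y = p y ^+ 2 * 'D_v f y + 2 * f y * p y * 'D_v p y.
Proof.
move=> gE y0 dp df; rewrite (@near_eq_derive _ _ _ _ (p ^+ 2 * f)).
  rewrite deriveM; [|exact/diff_derivable/differentiableX|exact: diff_derivable].
  by rewrite deriveX; [rewrite /GRing.scale /= !fctE expr1; ring
                      |exact: diff_derivable].
by near=> z; apply: gE; near: z; exact: (near_neq0 y0).
Unshelve. all: by end_near. Qed.

Section Conformal.
Variables f g p : 'rV[R]_n -> R.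
Hypotheses (f2 : diff2_slit f) (p2 : diff2_slit p).
Hypothesis gE : forall y, y != 0 -> g y = p y ^+ 2 * f y.

Lemma hessian_conformal (i j : 'I_n) y :
  (forall z k, z != 0 -> 'D_('e_k) p z = 0) -> y != 0 ->
  'D_('e_i) ('D_('e_j) g) y = p y ^+ 2 * 'D_('e_i) ('D_('e_j) f) y.
Proof.
move=> dp0 y0.
(* The partial derivatives satisfy the same relation at every nonzero [z], so it can be
   differentiated again. *)
have E z : z != 0 -> 'D_('e_j) g z = p z ^+ 2 * 'D_('e_j) f z.
  move=> z0; rewrite (derive_conformal _ gE)//; [|exact: (p2 z0).1|exact: (f2 z0).1].
  by rewrite dp0// mulr0 addr0.
rewrite (derive_conformal _ E)//; [|exact: (p2 y0).1|exact: (f2 y0).2].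
by rewrite dp0// mulr0 addr0.
Qed.

Lemma conformal_factor_constant (l : 'rV[R]_n -> R) (i : 'I_n) y :
  pos_homogeneous 2 f -> pos_homogeneous 2 g -> diff2_slit g ->
  (forall z, z != 0 -> 0 < f z) -> (forall z, z != 0 -> 0 < p z) ->
  (forall z j k, z != 0 ->
    'D_('e_j) ('D_('e_k) g) z = l z * 'D_('e_j) ('D_('e_k) f) z) ->
  y != 0 -> 'D_('e_i) p y = 0.
Proof.
move=> hf hg g2 f0 p0 H y0.
have grad j : 'D_('e_j) g y = l y * 'D_('e_j) f y.
  rewrite -(hessian_radial _ hg)// -(hessian_radial _ hf)// mulr_sumr.
  by apply: eq_bigr => k _; rewrite H// mulrCA.
(* By Euler in degree 2 both sides are radial derivatives, which [grad] compares term by term. *)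
have /(mulfI _) lE : 2 * g y = 2 * (l y * f y).
  rewrite -(euler_homogeneous hg)//; last exact: (g2 y y0).1.
  rewrite mulrCA -(euler_homogeneous hf)//; last exact: (f2 y0).1.
  rewrite !derive_sum_delta; [|exact: (f2 y0).1|exact: (g2 y y0).1].
  by rewrite mulr_sumr; apply: eq_bigr => k _; rewrite grad mulrCA.
have {}lE : l y = p y ^+ 2.
  apply/esym/(mulIf (lt0r_neq0 (f0 y y0))).
  by rewrite -gE// lE// pnatr_eq0.
(* Two expressions of the same derivative of [g]: their common term cancels, and [2 * f y * p y] is
   nonzero in what remains. *)
have := grad i; rewrite (derive_conformal _ gE)//; [|exact: (p2 y0).1|exact: (f2 y0).1].
rewrite lE -[RHS]addr0 => /addrI/eqP.
by rewrite !mulf_eq0 pnatr_eq0 (gt_eqF (f0 y y0)) (gt_eqF (p0 y y0)) => /eqP.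
Qed.

End Conformal.
End Gradient.

(** Chain rule for the inclusion of a fibre; it turns joint smoothness in [(x, y)] into derivatives
    in [y] alone. *)
Lemma derive_slice (R : realType) (U V : normedModType R) (h : U * V -> R) x y v :
  differentiable h (x, y) ->
  differentiable (fun z => h (x, z)) y /\
  'D_v (fun z => h (x, z)) y = 'd h (x, y) (0, v).
Proof.
move=> dh; have dp : is_diff y (fun z : V => (x, z)) (fun w => (0, w)).
  exact: (is_diff_pair (is_diff_cst x y) (is_diff_id y)).
have dhp : differentiable (h \o (fun z => (x, z))) y by exact: differentiable_comp.
by split=> //; rewrite deriveE// diff_comp// /= diff_val.
Qed.

(** * From functions on the slit tangent bundle to functions on a fibre *)

Section Slit.
Context (R : realType) (n : nat) (M : manifold R n).
Implicit Types (f g F : tangent M -> R) (a : chart_index M) (x y : 'rV[R]_n).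

Lemma slit_tvec a x y : img a x -> y != 0 -> slit (tvec a x y).
Proof. by move=> ax y0; exists a; rewrite (tvecK y ax).2. Qed.

(** The components agree by linearity of the differentials of chart changes, and the proof fields by
    irrelevance. *)
Lemma tscale_tvec a x y (t : R) : tvec a x (t *: y) = tscale t (tvec a x y).
Proof.
rewrite /tscale/= /tvec; move: (@tvec_change _ _ _ _ _ _) (@tvec_out _ _ _ _ _ _).
move: (@tscale_change _ _ _ _ _) (@tscale_out _ _ _ _ _) => /=.
have -> : tvec_comp a x (t *: y) = fun b => t *: tvec_comp a x y b.
  apply/funext => b; rewrite /tvec_comp; case: ifP => _; last by rewrite scaler0.
  by rewrite linearZ.
by move=> p q p' q'; congr Tangent; exact: Prop_irrelevance.
Qed.

Lemma slit_open a :
  open [set z : 'rV[R]_n * 'rV[R]_n | img a z.1 /\ z.2 != 0]%classic.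
Proof.
apply: openI.
  apply: (open_comp (f := fst) (D := img a)); last exact: img_open.
  by move=> z _; exact: cvg_fst.
apply: (open_comp (f := snd) (D := [set y : 'rV[R]_n | y != 0]%classic)).
  by move=> z _; exact: cvg_snd.
by rewrite openE => y /near_neq0.
Qed.

Lemma smooth_slitM f g :
  smooth_slit f -> smooth_slit g -> smooth_slit (fun v => f v * g v).
Proof. by move=> sf sg a k; apply: (CkM (@slit_open a)); [exact: sf|exact: sg]. Qed.

Lemma smooth_slit_diff2 f a x : smooth_slit f -> img a x -> diff2_slit (loc f a x).
Proof.
move=> sf ax y y0; have [df ddf] := sf a 2.
have dloc z v (z0 : z != 0) := derive_slice v (df (x, z) (conj ax z0)).
split=> [|v]; first exact: (dloc y 0 y0).1.
(* Near [y], the fibre derivative along [v] is the joint differential in the direction [(0, v)],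
   itself differentiable by the C^2 hypothesis. *)
have := (derive_slice 0 ((ddf (0, v)).1 (x, y) (conj ax y0))).1.
apply: near_eq_differentiable; near=> z; apply/esym; apply: (dloc z v _).2.
near: z; exact: (near_neq0 y0).
Unshelve. all: by end_near. Qed.

Lemma finsler_sqr_homogeneous F a x : finsler_metric F -> img a x ->
  pos_homogeneous 2 (loc (fun v => F v ^+ 2) a x).
Proof.
move=> hF ax t y t0 y0; rewrite /loc tscale_tvec finsler_homogeneous//.
  by rewrite exprMn.
exact: slit_tvec.
Qed.

End Slit.

Theorem lemma2p2 (R : realType) (n : nat) (M : manifold R n)
    (F Fbar Psi : tangent M -> R)
    (hF : finsler_metric F) (hFbar : finsler_metric Fbar)
    (Psi_smooth : smooth_slit Psi)
    (Psi_pos : forall v, slit v -> 0 < Psi v)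
    (Fbar_eq : forall v, slit v -> Fbar v = Psi v * F v) :
  (exists lambda : tangent M -> R,
     [/\ smooth_slit lambda,
         forall v, slit v -> 0 < lambda v &
         forall (a : chart_index M) (x y : 'rV[R]_n), img a x -> y != 0 ->
           metric_tensor Fbar a x y =
             loc lambda a x y *: metric_tensor F a x y])
  <->
  (forall (a : chart_index M) (i : 'I_n) (x y : 'rV[R]_n),
     img a x -> y != 0 -> dy i (loc Psi a) x y = 0).
Proof.
have diff2_sqr (G : tangent M -> R) a x : finsler_metric G -> img a x ->
    diff2_slit (loc (fun v => G v ^+ 2) a x).
  move=> hG; apply: smooth_slit_diff2; apply: smooth_slitM; exact: finsler_smooth.
have sqrE a x : img a x -> forall y, y != 0 ->
    loc (fun v => Fbar v ^+ 2) a x y =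
    loc Psi a x y ^+ 2 * loc (fun v => F v ^+ 2) a x y.
  move=> ax y y0; rewrite /loc Fbar_eq ?exprMn//.
  exact: slit_tvec.
split=> [[l [_ _ gl]] a i x y ax y0|dPsi].
  apply: (conformal_factor_constant (diff2_sqr _ _ _ hF ax)
    (smooth_slit_diff2 Psi_smooth ax) (sqrE a x ax) (l := loc l a x)) => //.
  - exact: finsler_sqr_homogeneous.
  - exact: finsler_sqr_homogeneous.
  - exact: diff2_sqr.
  - by move=> z z0; rewrite exprn_gt0// (finsler_pos hF)//; exact: slit_tvec.
  - by move=> z z0; apply: Psi_pos; exact: slit_tvec.
  (* The factor 1/2 in [metric_tensor] cancels, leaving a relation between Hessians. *)
  - move=> z j k z0; have /matrixP/(_ j k) := gl a x z ax z0.
    by rewrite !mxE mulrCA => /mulfI; apply; rewrite invr_eq0 pnatr_eq0.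
(* The square of [Psi] is written as a product to match [smooth_slitM]. *)
exists (fun v => Psi v * Psi v); split.
- exact: smooth_slitM.
- by move=> v sv; rewrite mulr_gt0 ?Psi_pos.
move=> a x y ax y0; apply/matrixP => i j; rewrite !mxE mulrCA; congr (_ * _).
apply: (hessian_conformal (diff2_sqr _ _ _ hF ax) (smooth_slit_diff2 Psi_smooth ax)
  (sqrE a x ax)) => // z k z0.
exact: dPsi.
Qed.
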